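(* A branchwise-real tree order $X$ is continuously gradable if and only if every well-stratified subtree $T\subseteq X$ (i.e. every subset $T$ which, with the induced order, is a well-stratified tree) admits an $\mathbb{R}$-grading.
   Context: A tree order is a partial order with a minimum element (root) such that for every $x$ the set $\{y\mid y\le x\}$ is linearly ordered; a branch is a maximal linearly ordered subset. A branchwise-real tree order is a tree order in which every branch is order-isomorphic to a real interval and any two elements have a greatest lower bound. A well-stratified tree is a tree order in which every set $\{y\mid y\le x\}$ is well-ordered. An $\mathbb{R}$-grading of a partial order $P$ is a strictly monotonic map $P\to\mathbb{R}$. An $\mathbb{R}$-grading $\ell$ of a branchwise-real tree order $X$ is continuous if for all $x<y$ the restriction of $\ell$ to $[x,y]=\{z\mid x\le z\le y\}$ is an order-isomorphism onto $[\ell(x),\ell(y)]$; $X$ is continuously gradable if it admits a continuous $\mathbb{R}$-grading. *)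

(* Defs.v *)
From mathcomp Require Import all_boot all_order all_algebra.
From mathcomp Require Import boolp wochoice classical_sets functions.
From mathcomp Require Import set_interval reals.
Set Implicit Arguments.
Unset Strict Implicit.
Unset Printing Implicit Defensive.
Import Order.TTheory.
Local Open Scope classical_set_scope.
Local Open Scope order_scope.

(* A subset [A : set X] stands for the partial order induced on it by the order
   of [X]; the partial order [X] itself is [[set: X]]. A map defined only on [A]
   is represented by a total map whose values outside [A] are irrelevant. *)

Definition down_set d (X : porderType d) (A : set X) (x : X) : set X :=
  [set y | A y /\ y <= x].

Definition tree_order d (X : porderType d) (A : set X) : Prop :=
  (exists2 r, A r & lbound A r) /\
  forall x, A x -> chain <=%O [in down_set A x].

Definition well_stratified_tree d (X : porderType d) (A : set X) : Prop :=
  tree_order A /\ forall x, A x -> wo_chain <=%O [in down_set A x].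

Definition branch d (X : porderType d) (B : set X) : Prop :=
  chain <=%O [in B] /\
  forall C : set X, chain <=%O [in C] -> B `<=` C -> C = B.

Definition order_isomorphism d d' (X : porderType d) (Y : porderType d')
    (A : set X) (B : set Y) (f : X -> Y) : Prop :=
  set_bij A B f /\ {in A &, {mono f : x y / x <= y}}.

(* The real intervals are the sets [[set` i]] for [i : interval R]; they may be
   open, closed, half-open, bounded or not, or reduced to a point. *)
Definition branchwise_real_tree_order (R : realType) d (X : porderType d) :
    Prop :=
  [/\ tree_order [set: X],
      forall B : set X, branch B ->
        exists (i : interval R) (f : X -> R), order_isomorphism B [set` i] f
    & forall x y : X, infimums [set x; y] !=set0].

Definition R_grading (R : realType) d (X : porderType d) (A : set X)
    (l : X -> R) : Prop :=
  {in A &, {homo l : x y / x < y}}.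

Definition R_gradable (R : realType) d (X : porderType d) (A : set X) : Prop :=
  exists l : X -> R, R_grading A l.

Definition continuous_R_grading (R : realType) d (X : porderType d)
    (l : X -> R) : Prop :=
  R_grading [set: X] l /\
  forall x y : X, x < y -> order_isomorphism `[x, y] `[l x, l y] l.

Definition continuously_gradable (R : realType) d (X : porderType d) : Prop :=
  exists l : X -> R, continuous_R_grading l.

(* Main.v *)
Require Import Defs.
From mathcomp Require Import all_boot all_order all_algebra.
From mathcomp Require Import boolp wochoice classical_sets functions.
From mathcomp Require Import set_interval reals.
From mathcomp Require Import constructive_ereal lra.

(* Fix a well-order [W] of [X] and let [m x] be the [W]-least element above [x].
   Since [m] is monotone along chains, its fibres (the segments) partition [X]
   into convex chains, and those meeting a given down-set are well-ordered.
   Choosing two points [o a < p a] in every nontrivial segment, of top [a], gives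
   a well-stratified subtree, hence a grading [g], which may be taken bounded.
   Let the segment of [a] contribute a function which is null below [p a] and
   grows continuously between [p a] and [a] by [g (p a) - g (o a)]: paying with
   the jump of [g] *before* [p a] bounds the total contribution, whatever the
   points where a chain leaves the segments which it meets. The sum of all
   contributions is continuous along chains. Summing these functions with
   weights [2^-n], for a sequence of choices such that [p_n a] is coinitial in
   the segment of [a], gives a strictly increasing function: minimality of
   [m z] over [z] in [(x, y]] shows that [(x, z]] lies in a single segment. *)

Set Implicit Arguments.
Unset Strict Implicit.
Unset Printing Implicit Defensive.
Import Order.TTheory GRing.Theory Num.Theory.
Local Open Scope ring_scope.
Local Open Scope classical_set_scope.
Local Open Scope order_scope.

(** * Monotone real functions without jumps along chains *)

(* Since [f] is monotone, the absence of one-sided jumps amounts to continuity on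
   every chain carrying the topology of a real interval; unlike surjectivity onto
   intervals, it is stable under sums. *)
Definition jumpless (R : realType) d (X : porderType d) (f : X -> R) : Prop :=
  [/\ {homo f : x y / x <= y},
      forall x z (e : R), x < z -> 0 < e -> exists2 u, x <= u < z & f z - f u <= e
    & forall z y (e : R), z < y -> 0 < e -> exists2 v, z < v <= y & f v - f z <= e].

(** A tolerance [e / k] for [f] becomes the tolerance [e] after the [k]-Lipschitz map [h]. *)
Lemma jumpless_comp (R : realType) d (X : porderType d) (f : X -> R)
    (h : R -> R) (k : R) :
  0 < k -> {homo h : s t / s <= t} ->
  (forall s t, s <= t -> h t - h s <= k * (t - s)) ->
  jumpless f -> jumpless (h \o f).
Proof.
move=> k0 hh hk [fm fl fr]; split=> [x y /fm/hh //|x z e xz e0|z y e zy e0].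
- have [u /andP[xu uz] fe] := fl x z (e / k) xz (divr_gt0 e0 k0).
  exists u; first by rewrite xu.
  apply: le_trans (hk _ _ (fm _ _ (ltW uz))) _.
  by rewrite mulrC -ler_pdivlMr.
- have [v /andP[zv vy] fe] := fr z y (e / k) zy (divr_gt0 e0 k0).
  exists v; first by rewrite zv.
  apply: le_trans (hk _ _ (fm _ _ (ltW zv))) _.
  by rewrite mulrC -ler_pdivlMr.
Qed.

Lemma jumplessD (R : realType) d (X : porderType d) (f g : X -> R) :
  jumpless f -> jumpless g -> jumpless (fun x => f x + g x).
Proof.
move=> [fm fl fr] [gm gl gr]; split=> [x y xy|x z e xz e0|z y e zy e0].
- exact: lerD (fm _ _ xy) (gm _ _ xy).
- have e20 : 0 < e / 2 by rewrite divr_gt0.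
  have [u /andP[xu uz] fe] := fl x z _ xz e20.
  (* The second point is sought between the first one and [z], where monotonicity of [f] preserves
     the first estimate. *)
  have [v /andP[uv vz] ge] := gl u z _ uz e20.
  exists v; first by rewrite (le_trans xu).
  have := fm _ _ uv; lra.
- have e20 : 0 < e / 2 by rewrite divr_gt0.
  have [u /andP[zu uy] fe] := fr z y _ zy e20.
  have [v /andP[zv vu] ge] := gr z u _ zu e20.
  exists v; first by rewrite zv (le_trans vu).
  have := fm _ _ vu; lra.
Qed.

Lemma jumpless_cst (R : realType) d (X : porderType d) (c : R) :
  jumpless (fun _ : X => c).
Proof.
split=> // [x z e xz /ltW e0|z y e zy /ltW e0].
- by exists x; rewrite ?lexx ?subrr.
- by exists y; rewrite ?lexx ?zy ?subrr.
Qed.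

Lemma jumpless_sum (R : realType) d (X : porderType d) (I : Type)
    (phi : I -> X -> R) (J : seq I) :
  (forall i, jumpless (phi i)) -> jumpless (fun x => \sum_(i <- J) phi i x).
Proof.
move=> phij; elim: J => [|i J IH].
  by under eq_fun do rewrite big_nil; exact: jumpless_cst.
by under eq_fun do rewrite big_cons; exact: jumplessD.
Qed.

(** * Sums of nonnegative functions over arbitrary index sets *)

(* The sum of a family of nonnegative functions over a possibly uncountable index
   set; it is [0] where the finite sums are unbounded. *)
Definition sup_sum (R : realType) (X : Type) (I : eqType) (phi : I -> X -> R)
    (x : X) : R :=
  sup [set s | exists2 J : seq I, uniq J & s = \sum_(i <- J) phi i x].

Section SupSum.
Context (R : realType) d (X : porderType d) (I : eqType) (phi : I -> X -> R).
Context (C : R).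
Hypothesis phi_ge0 : forall i x, 0 <= phi i x.
Hypothesis phi_le : forall (J : seq I) x, uniq J -> \sum_(i <- J) phi i x <= C.

Lemma le_sup_sum (J : seq I) (x : X) :
  uniq J -> \sum_(i <- J) phi i x <= sup_sum phi x.
Proof.
move=> uJ; apply: ub_le_sup; last by exists J.
by exists C => _ [K uK ->]; exact: phi_le.
Qed.

Lemma sup_sum_le (x : X) (b : R) :
  (forall J : seq I, uniq J -> \sum_(i <- J) phi i x <= b) -> sup_sum phi x <= b.
Proof.
move=> ub; apply: ge_sup; first by exists 0, [::] => //; rewrite big_nil.
by move=> _ [K uK ->]; exact: ub.
Qed.

Lemma sup_sum_ge0 (x : X) : 0 <= sup_sum phi x.
Proof. by have := @le_sup_sum [::] x isT; rewrite big_nil. Qed.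

Hypothesis phij : forall i, jumpless (phi i).

(** The difference is the sum of the functions outside [J], all monotone. Removing one index yields
    strict growth; removing a large finite part leaves a tail that is uniformly small below a given
    point. *)
Lemma sup_sum_tail_homo (J : seq I) : uniq J ->
  {homo (fun x => sup_sum phi x - \sum_(i <- J) phi i x) : x y / x <= y}.
Proof.
move=> uJ x y xy; rewrite lerBlDr; apply: sup_sum_le => K uK.
have cK : \sum_(i <- K) phi i x <=
    \sum_(i <- J) phi i x + \sum_(i <- K | i \notin J) phi i x.
  rewrite (bigID (fun i => i \in J)) /=; apply: lerD => //.
  have pKJ : perm_eq [seq i <- K | i \in J] [seq i <- J | i \in K].
    apply: uniq_perm; rewrite ?filter_uniq // => i.
    by rewrite !mem_filter andbC.
  rewrite -big_filter (perm_big _ pKJ) big_filter.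
  rewrite [leRHS](bigID (fun i => i \in K)) /= lerDl.
  by apply: sumr_ge0 => i _.
have uJK : uniq (J ++ [seq i <- K | i \notin J]).
  rewrite cat_uniq uJ filter_uniq // andbT /=.
  by apply/hasPn => i; rewrite mem_filter => /andP[].
have := le_sup_sum y uJK; rewrite big_cat /= big_filter.
have : \sum_(i <- K | i \notin J) phi i x <= \sum_(i <- K | i \notin J) phi i y.
  by apply: ler_sum => i _; have [+ _ _] := phij i; apply.
lra.
Qed.

Lemma sup_sum_homo : {homo sup_sum phi : x y / x <= y}.
Proof.
by move=> x y /(@sup_sum_tail_homo [::] isT) /=; rewrite !big_nil !subr0.
Qed.

Lemma sup_sum_lt (i : I) (x y : X) :
  x <= y -> phi i x < phi i y -> sup_sum phi x < sup_sum phi y.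
Proof.
move=> /(@sup_sum_tail_homo [:: i] isT) /=; rewrite !big_seq1; lra.
Qed.

Lemma sup_sum_approx (y : X) (e : R) : 0 < e ->
  exists2 J : seq I, uniq J & sup_sum phi y - \sum_(i <- J) phi i y <= e.
Proof.
move=> e0.
have [||_ [J uJ ->] lt] := @sup_adherent R
    [set s | exists2 J : seq I, uniq J & s = \sum_(i <- J) phi i y] e => //.
  split; first by exists 0, [::] => //; rewrite big_nil.
  by exists C => _ [K uK ->]; exact: phi_le.
by exists J => //; rewrite lerBlDl -lerBlDr ltW.
Qed.

(** A finite part [J] is chosen whose tail at the upper point is at most [e / 2]. By monotonicity
    the tail is no larger below that point, and the finite sum over [J] has no jumps. *)
Lemma jumpless_sup_sum : jumpless (sup_sum phi).
Proof.
have ge0 J x : uniq J -> 0 <= sup_sum phi x - \sum_(i <- J) phi i x.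
  by move=> uJ; rewrite subr_ge0 le_sup_sum.
split=> [|x z e xz e0|z y e zy e0]; first exact: sup_sum_homo.
- have e20 : 0 < e / 2 by rewrite divr_gt0.
  have [J uJ Je] := sup_sum_approx z e20.
  have [_ + _] := jumpless_sum J phij => /(_ x z _ xz e20)[u xuz ue].
  by exists u => //; have := ge0 J u uJ; lra.
- have e20 : 0 < e / 2 by rewrite divr_gt0.
  have [J uJ Je] := sup_sum_approx y e20.
  have [_ _] := jumpless_sum J phij => /(_ z y _ zy e20)[v /andP[zv vy] ve].
  exists v; first by rewrite zv.
  have := ge0 J z uJ; have := sup_sum_tail_homo uJ vy; move=> /=; lra.
Qed.

End SupSum.

(** * Total length of disjoint real intervals *)

Lemma seq_argmax (R : realType) (I : eqType) (r : I -> R) (i : I) (J : seq I) :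
  exists2 k, k \in i :: J & {in i :: J, forall j, r j <= r k}.
Proof.
elim: J i => [|j J IH] i.
  by exists i => [|k]; rewrite ?mem_head // mem_seq1 => /eqP->.
have [k kJ kmax] := IH j; have [ik|/ltW ki] := leP (r i) (r k).
  exists k => [|h]; first by rewrite inE kJ orbT.
  by rewrite inE => /predU1P[->//|/kmax].
exists i => [|h]; first by rewrite mem_head.
by rewrite inE => /predU1P[->//|/kmax/le_trans]; apply.
Qed.

(** Induction on the number of intervals: once the one with the greatest right end [r i] is removed,
    the others lie between [m] and [l i], which becomes the new [M]. *)
Lemma sum_disjoint_le (R : realType) (I : eqType) (l r : I -> R) (J : seq I)
    (m M : R) :
  uniq J -> m <= M -> {in J, forall i, m <= l i /\ r i <= M} ->
  {in J, forall i, l i < r i} ->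
  {in J &, forall i j, i != j -> r i <= l j \/ r j <= l i} ->
  \sum_(i <- J) (r i - l i) <= M - m.
Proof.
elim: {J}(size J) {-2}J (leqnn (size J)) M => [|n IH] J.
  by case: J => // _ M; rewrite big_nil subr_ge0.
case: J => [|i0 J0] sJ M uJ mM lr lt disj; first by rewrite big_nil subr_ge0.
set J := i0 :: J0 in sJ uJ lr lt disj *.
have [i iJ imax] := seq_argmax r i0 J0.
have [ml rM] := lr _ iJ.
have remJ j : j \in rem i J -> j != i /\ j \in J.
  by rewrite mem_rem_uniq // inE => /andP[].
rewrite (big_rem _ iJ) /=.
have : \sum_(j <- rem i J) (r j - l j) <= l i - m.
  apply: IH => //; first by rewrite size_rem.
  - exact: rem_uniq.
  - move=> j /remJ[ji jJ]; split; first by case: (lr _ jJ).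
    case: (disj _ _ jJ iJ ji) => // ij.
    by have := lt _ jJ; have := imax _ jJ; lra.
  - by move=> j /remJ[_ /lt].
  - by move=> j k /remJ[_ jJ] /remJ[_ kJ]; exact: disj.
lra.
Qed.

(** The powers are the lengths of the consecutive intervals cut out of [[0, 2]] by the points
    [2 - 2 * 2^-n]. *)
Lemma sum_half_le2 (R : realType) (J : seq nat) :
  uniq J -> \sum_(n <- J) (2^-1 : R) ^+ n <= 2.
Proof.
move=> uJ; pose l n : R := 2 - 2 * 2^-1 ^+ n; pose r n := l n.+1.
have h0 n : 0 < (2^-1 : R) ^+ n by rewrite exprn_gt0 // invr_gt0.
have lm m n : (m <= n)%N -> l m <= l n.
  move=> mn; rewrite /l lerB // ler_wpM2l // ler_wiXn2l ?invr_ge0 //.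
  by rewrite invf_le1 // ler1n.
have -> : \sum_(n <- J) (2^-1 : R) ^+ n = \sum_(n <- J) (r n - l n).
  by apply: eq_bigr => n _; rewrite /r /l exprS; lra.
have -> : 2 = 2 - 0 :> R by rewrite subr0.
apply: sum_disjoint_le => // [n _|n _|m n _ _].
- rewrite (le_trans _ (lm 0 n _)) // /l ?expr0; last by lra.
  by split=> //; rewrite /r /l; have := h0 n.+1; lra.
- by rewrite /r /l exprS; have := h0 n; lra.
- by rewrite neq_ltn => /orP[/lm|/lm]; [left|right].
Qed.

(** * Real coordinates on principal down-sets *)

Lemma tree_order_comparable d (X : porderType d) (a x y : X) :
  tree_order [set: X] -> x <= a -> y <= a -> (x <= y) || (y <= x).
Proof. by move=> [_ /(_ a I) ch] xa ya; apply: ch; rewrite inE. Qed.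

(** Identifies the down-set of [a] with a real interval: the second clause excludes gaps in the
    image. Values outside the down-set are arbitrary. *)
Definition chart (R : realType) d (X : porderType d) (a : X) (e : X -> R) :
    Prop :=
  (forall x y, x <= a -> y <= a -> (e x <= e y) = (x <= y)) /\
  forall x y c, x <= y -> y <= a -> e x <= c <= e y ->
    exists2 z, x <= z <= y & e z = c.

Lemma chart_lt (R : realType) d (X : porderType d) (a : X) (e : X -> R) x y :
  chart a e -> x <= a -> y <= a -> (e x < e y) = (x < y).
Proof. by move=> [em _] xa ya; rewrite !lt_leAnge !em. Qed.

(** Zorn's lemma is applied to the sets [B] whose union with the down-set of [a] is a chain, so that
    the empty family needs no separate treatment. *)
Lemma exists_branch_above d (X : porderType d) (a : X) : tree_order [set: X] ->
  exists2 B : set X, branch B & forall x, x <= a -> B x.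
Proof.
move=> tX.
pose P (B : set X) := forall x y, B x -> B y -> (x <= y) || (y <= x).
pose Da := [set x | x <= a].
have [F FP Ftot|B [PB Bmax]] := @Zorn_bigcup X (fun B => P (B `|` Da)).
  move=> x y [[B FB Bx]|xa] [[C FC Cy]|ya]; last first.
  - exact: tree_order_comparable xa ya.
  - by apply: (FP C FC); [right|left].
  - by apply: (FP B FB); [left|right].
  - have [BC|CB] := Ftot B C FB FC.
      by apply: (FP C FC); left => //; exact: BC.
    by apply: (FP B FB); left => //; exact: CB.
exists (B `|` Da); last by right.
split=> [x y|C chC BC]; first by rewrite !inE; exact: PB.
have [/eqP CB|BneC] := eqVneq C B.
  by apply/seteqP; split=> //; rewrite (eqP CB) => x; left.
have BC' : B `<=` C by move=> x Bx; apply: BC; left.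
have [] := Bmax C; first by rewrite properEneq eq_sym.
have -> : C `|` Da = C.
  by apply/seteqP; split=> [x [//|xa]|x]; [apply: BC; right|left].
by move=> x y Cx Cy; apply: chC; rewrite inE.
Qed.

Lemma itv_between (R : realType) (i : interval R) (x y c : R) :
  x \in i -> y \in i -> x <= c <= y -> c \in i.
Proof.
case: i => [[[] l|[]] [[] u|[]]]; rewrite !in_itv /=; lra.
Qed.

(** The coordinates of the [p n] decrease to the infimum [s] of those of [S], which exists thanks to
    the root. As [S] may have a least element, only elements with another one below are eventually
    passed. *)
Lemma coinitial_sequence (R : realType) d (X : porderType d) (r a x0 : X)
    (e : X -> R) (S : set X) :
  (forall x, r <= x) -> chart a e -> (forall x, S x -> x <= a) ->
  (forall x y, S x -> x <= y <= a -> S y) -> S x0 -> x0 < a ->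
  exists p : nat -> X,
    (forall n, [/\ S (p n), p n < a & p n.+1 < p n]) /\
    forall x y, S x -> S y -> x < y -> exists n, p n < y.
Proof.
move=> rle che Sa Sup Sx0 x0a; have [em es] := che.
pose s := inf (e @` S).
have sle x : S x -> s <= e x.
  move=> Sx; apply: ge_inf; last by exists x.
  by exists (e r) => _ [y Sy <-]; rewrite em // Sa.
have sa : s < e a.
  by apply: le_lt_trans (sle _ Sx0) _; rewrite (chart_lt che) // ltW.
(* The shift to [n.+2] puts already [c 0] strictly below [e a]. *)
pose c n := s + (e a - s) / n.+2%:R.
have as0 : 0 < e a - s by rewrite subr_gt0.
have cs n : s < c n by rewrite ltrDl divr_gt0.
have ca n : c n < e a.
  by rewrite -ltrBrDl ltr_pdivrMr // ltr_pMr // ltr1n.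
have cc n : c n.+1 < c n.
  by rewrite ltrD2l ltr_pM2l // ltf_pV2 ?posrE // ltr_nat.
have pP n : exists p, S p /\ e p = c n.
  have [|_ [x Sx <-] xc] := @inf_lt R (e @` S) (c n) _ (cs n).
    by exists (e x0), x0.
  have [|p /andP[xp pa] ep] := es x a (c n) (Sa _ Sx) (lexx a).
    by rewrite !ltW.
  by exists p; split=> //; apply: Sup Sx _; rewrite xp.
have [p {}pP] := choice pP.
have Sp n : S (p n) by case: (pP n).
have ep n : e (p n) = c n by case: (pP n).
exists p; split=> [n|x y Sx Sy xy].
  split=> //.
  - by rewrite -(chart_lt che) ?ep // Sa.
  - by rewrite -(chart_lt che) ?ep // Sa.
have ys : 0 < e y - s.
  by rewrite subr_gt0 (le_lt_trans (sle _ Sx)) // (chart_lt che) // Sa.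
exists (Num.bound ((e a - s) / (e y - s))).
rewrite -(chart_lt che) ?Sa // ep /c -ltrBrDl ltr_pdivrMr // mulrC.
rewrite -ltr_pdivrMr //.
apply: lt_le_trans (archi_boundP _) _; first by rewrite divr_ge0 // ltW.
by rewrite ler_nat -addn2 leq_addr.
Qed.

(** An intermediate value argument: the point [z] whose coordinate is the supremum of those with
    [f u <= c] satisfies [f z = c], since otherwise [f] would jump to the right or to the left of
    [z]. *)
Lemma jumpless_continuous_grading (R : realType) d (X : porderType d)
    (e : X -> X -> R) (f : X -> R) :
  tree_order [set: X] -> (forall a, chart a (e a)) ->
  jumpless f -> {homo f : x y / x < y} -> continuous_R_grading f.
Proof.
move=> tX che [fm fl fr] fs; split=> [x y _ _|x y xy]; first exact: fs.
have fmono u v : u <= y -> v <= y -> (f u <= f v) = (u <= v).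
  move=> uy vy; apply/idP/idP => [|/fm //].
  have /orP[//|] := tree_order_comparable tX uy vy.
  by rewrite le_eqVlt => /predU1P[->|/fs]; rewrite ?lexx // leNgt => ->.
split; last first.
  move=> u v /set_mem + /set_mem; rewrite /= !in_itv /=.
  by move=> /andP[_ uy] /andP[_ vy]; exact: fmono.
split=> [u /=|u v|c /=].
- by rewrite !in_itv /= => /andP[/fm -> /fm ->].
- move=> /set_mem + /set_mem; rewrite /= !in_itv /=.
  move=> /andP[_ uy] /andP[_ vy] fuv.
  by apply: le_anti; rewrite -(fmono u v) // -(fmono v u) // fuv lexx.
rewrite in_itv /= => /andP[xc cy]; have [em es] := che y.
pose A := [set u | x <= u <= y /\ f u <= c].
have Ax : A x by rewrite /A /= lexx ltW.
have ubA : ubound (e y @` A) (e y y).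
  by move=> _ [u [/andP[_ uy] _] <-]; rewrite em.
have leA u : A u -> e y u <= sup (e y @` A).
  by move=> Au; apply: ub_le_sup; [exists (e y y)|exists u].
have [|z /andP[xz zy] ez] := es x y (sup (e y @` A)) (ltW xy) (lexx y).
  by rewrite leA //= ge_sup //; exists (e y x), x.
exists z; first by rewrite /= in_itv /= xz.
have [fzc|cfz|//] := ltgtP (f z) c.
- have zy' : z < y.
    by rewrite lt_neqAle zy andbT; apply: contraTneq fzc => ->; rewrite -leNgt.
  have [|v /andP[zv vy] fv] := fr z y (c - f z) zy'; first by rewrite subr_gt0.
  have /leA : A v by split; [rewrite (le_trans xz (ltW zv))|move: fv; lra].
  by rewrite -ez em // (lt_geF zv).
- have xz' : x < z.
    by rewrite lt_neqAle xz andbT; apply: contraTneq cfz => <-; rewrite -leNgt.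
  (* Halving the gap keeps [f u] strictly above [c], so [u] bounds [A] although it lies below its
     supremum. *)
  have [|u /andP[xu uz] fu] := fl x z ((f z - c) / 2) xz'.
    by rewrite divr_gt0 // subr_gt0.
  have uy : u <= y by rewrite (le_trans (ltW uz)).
  have : sup (e y @` A) <= e y u.
    apply: ge_sup; first by exists (e y x), x.
    move=> _ [v [/andP[xv vy] fv] <-]; rewrite em //.
    have /orP[//|/fm uv] := tree_order_comparable tX vy uy.
    by exfalso; move: fv fu uv cfz; lra.
  by rewrite -ez em // (lt_geF uz).
Qed.

(** Composition with the meet with [a] extends the chart to the whole tree: along a chain it follows
    [e] while below [a] and is constant afterwards. *)
Lemma jumpless_chart_meet (R : realType) d (X : porderType d) (a : X)
    (e : X -> R) (mt : X -> X) :
  tree_order [set: X] -> chart a e ->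
  (forall x, mt x <= x) -> (forall x, mt x <= a) ->
  (forall x z, z <= x -> z <= a -> z <= mt x) -> jumpless (e \o mt).
Proof.
move=> tX che mtx mta mtP; have [em es] := che.
have mtm x y : x <= y -> mt x <= mt y.
  by move=> xy; apply: mtP => //; exact: le_trans (mtx x) xy.
have mtid x : x <= a -> mt x = x.
  by move=> xa; apply: le_anti; rewrite mtx mtP.
split=> [x y xy|x z eps xz e0|z y eps zy e0] /=; first by rewrite em // mtm.
- have [za|za] := boolP (z <= a).
    have xa : x <= a := le_trans (ltW xz) za.
    have xze : e x < e z by rewrite (chart_lt che).
    have [|u /andP[xu uz] eu] :=
        es x z (Num.max (e x) (e z - eps)) (ltW xz) za.
      by rewrite le_max lexx ge_max (ltW xze) gerBl /= ltW.
    have ua := le_trans uz za.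
    exists u; last by rewrite !mtid // eu lerBlDl -lerBlDr le_max lexx orbT.
    by rewrite xu -(chart_lt che) // eu gt_max xze ltrBlDr ltrDl e0.
  have mz : mt z < z.
    rewrite lt_neqAle mtx andbT; apply: contra za => /eqP <-; exact: mta.
  have [xm|mx] : x <= mt z \/ mt z <= x.
    by apply/orP; exact: tree_order_comparable tX (ltW xz) (mtx z).
  - exists (mt z); first by rewrite xm.
    by rewrite (mtid (mt z)) // subrr ltW.
  - exists x; first by rewrite lexx.
    have zx : mt z <= mt x by apply: mtP.
    by apply: le_trans (ltW e0); rewrite subr_le0 em.
- have [za|za] := boolP (z <= a); last first.
    exists y; first by rewrite zy lexx.
    have yz : mt y <= z.
      have /orP[//|zm] := tree_order_comparable tX (mtx y) (ltW zy).
      by rewrite (le_trans zm (mta y)) in za.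
    have yz' : mt y <= mt z by apply: mtP.
    by apply: le_trans (ltW e0); rewrite subr_le0 em.
  have zm : z <= mt y by apply: mtP => //; exact: ltW.
  have [zym|zlt] := eqVneq z (mt y).
    by exists y; rewrite ?zy ?lexx // (mtid z) // -zym subrr ltW.
  have zlt' : z < mt y by rewrite lt_neqAle zlt.
  have eze : e z < e (mt y) by rewrite (chart_lt che).
  have [|v /andP[zv vy] ev] :=
      es z (mt y) (Num.min (e (mt y)) (e z + eps)) zm (mta y).
    by rewrite ge_min lexx le_min (ltW eze) lerDl /= ltW.
  have va := le_trans vy (mta y).
  exists v; last by rewrite !mtid // ev lerBlDl ge_min lexx orbT.
  rewrite (le_trans vy (mtx y)) andbT -(chart_lt che) // ev lt_min eze.
  by rewrite ltrDl.
Qed.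

Lemma chart_exists (R : realType) d (X : porderType d) (a : X) :
  branchwise_real_tree_order R X -> exists e : X -> R, chart a e.
Proof.
move=> [tX chX _]; have [B brB aB] := exists_branch_above a tX.
have [i [e [[eB einj esurj] emono]]] := chX B brB.
have em x y : x <= a -> y <= a -> (e x <= e y) = (x <= y).
  by move=> /aB xB /aB yB; apply: emono; rewrite inE.
exists e; split=> // x y c xy ya /andP[xc cy]; have xa := le_trans xy ya.
have [|z Bz ez] := esurj c.
  by apply: (itv_between (eB x _) (eB y _)); rewrite ?xc //; exact: aB.
exists z => //; rewrite -!emono ?inE ?ez ?xc //; exact: aB.
Qed.

(** * Segments of a well-order and well-stratified subtrees *)

Lemma well_order_min (T : eqType) (W : rel T) (P : T -> Prop) :
  well_order W -> (exists x, P x) -> exists2 x, P x & forall y, P y -> W x y.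
Proof.
move=> Wwo [x Px].
have [|z [[/asboolP Pz zmin] _]] := Wwo (fun x => `[< P x >]).
  by exists x; apply/asboolP.
by exists z => // y Py; apply: zmin; apply/asboolP.
Qed.

Lemma well_order_anti (T : eqType) (W : rel T) (x y : T) :
  well_order W -> W x y -> W y x -> x = y.
Proof.
move=> Wwo xy yx.
have Wch : wo_chain W predT by move=> A _; exact: Wwo.
by apply: (wo_chain_antisymmetric Wch) => //; rewrite xy yx.
Qed.

Section Segments.
Context d (X : porderType d) (r : X) (W : rel X) (m : X -> X).
Hypothesis tX : tree_order [set: X].
Hypothesis rle : forall x, r <= x.
Hypothesis Wwo : well_order W.
Hypothesis m_ge : forall x, x <= m x.
Hypothesis m_min : forall x a, x <= a -> W (m x) a.

Lemma segment_homo x y : x <= y -> W (m x) (m y).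
Proof. by move=> xy; apply: m_min; exact: le_trans xy (m_ge y). Qed.

Lemma segment_up a x y : m x = a -> x <= y <= a -> m y = a.
Proof.
move=> mx /andP[xy ya]; apply: (well_order_anti Wwo); first exact: m_min.
by rewrite -{1}mx; exact: segment_homo.
Qed.

(** By [segment_up], [a] then lies in its own fibre, and it is the greatest element there. *)
Definition nontrivial_segment (a : X) : Prop := exists2 x, x < a & m x = a.

Lemma interval_segment (x y : X) : x < y ->
  exists2 z, x < z <= y & forall w, x < w <= z -> m w = m z.
Proof.
move=> xy; have [|_ [z /andP[xz zy] <-] zmin] := @well_order_min _ W
    (m @` [set z | x < z <= y]) Wwo.
  by exists (m y), y => //=; rewrite xy lexx.
exists z => [|w /andP[xw wz]]; first by rewrite xz.
apply: (well_order_anti Wwo); first exact: segment_homo.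
by apply: zmin; exists w => //=; rewrite xw (le_trans wz).
Qed.

(** In a nonempty set below some point, the [W]-least value of [m] singles out the lowest segment
    met. It contains at most two candidates for the minimum. *)
Lemma well_stratified_pairs (o p : X -> X) :
  (forall a, nontrivial_segment a -> [/\ m (o a) = a, m (p a) = a & o a < p a]) ->
  well_stratified_tree
    [set x | x = r \/ exists2 a, nontrivial_segment a & x = o a \/ x = p a].
Proof.
move=> opP; set T := [set x | _].
have chT x : T x -> chain <=%O [in down_set T x].
  move=> Tx y z; rewrite !inE => -[_ yx] [_ zx].
  exact: tree_order_comparable yx zx.
split.
  by split=> //; exists r; [left|move=> x _; exact: rle].
move=> x Tx; apply: antisymmetric_wo_chain.
  by move=> ? ? _ _; exact: le_anti.
move=> A subA [y0 Ay0].
have AT y : y \in A -> T y /\ y <= x by move=> /subA; rewrite inE.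
have [rA|rA] := boolP (r \in A); first by exists r; split=> // y _; exact: rle.
have Apair y : y \in A ->
    nontrivial_segment (m y) /\ (y = o (m y) \/ y = p (m y)).
  move=> yA; have [[yr|[a ga yop]] _] := AT _ yA; first by rewrite -yr yA in rA.
  by have [oa pa _] := opP a ga; case: yop => ->; rewrite ?oa ?pa; split=> //;
    first [by left | by right].
have [|_ [u uA <-] umin] := @well_order_min _ W (m @` [set y | y \in A]) Wwo.
  by exists (m y0), y0.
have [gu uop] := Apair _ uA; have [_ _ opu] := opP _ gu.
(* The element [u] need not be the minimum, but whatever lies below it shares its segment and so
   belongs to the same pair. *)
have Au v : v \in A -> u <= v \/ (v = o (m u) \/ v = p (m u)).
  move=> vA; have [_ vx] := AT _ vA; have [_ ux] := AT _ uA.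
  have /orP[uv|vu] := tree_order_comparable tX ux vx; first by left.
  have muv : m v = m u.
    by apply: (well_order_anti Wwo); [exact: segment_homo|apply: umin; exists v].
  by right; rewrite -muv; have [] := Apair _ vA.
have op' : o (m u) <= p (m u) by exact: ltW.
have [oA|oA] := boolP (o (m u) \in A).
  exists (o (m u)); split=> // v /Au[|[->|->]] //; apply: le_trans.
  by case: uop => eu; rewrite [leRHS]eu.
have up : u = p (m u) by case: uop => // uo; rewrite -uo uA in oA.
exists u; split=> // v vA; have [//|[vo|vp]] := Au v vA.
  by rewrite -vo vA in oA.
by rewrite vp -up.
Qed.

End Segments.

(** * Growth functions of the segments and the bound on their sum *)

Lemma clamp_homo_lipschitz (R : realType) (k c : R) : 0 < k ->
  {homo (fun t => k * Num.max 0 (t - c)) : s t / s <= t} /\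
  forall s t, s <= t ->
    k * Num.max 0 (t - c) - k * Num.max 0 (s - c) <= k * (t - s).
Proof.
move=> k0.
have mono s t : s <= t -> Num.max 0 (s - c) <= Num.max 0 (t - c).
  by rewrite !maxEle; case: ifP; case: ifP; lra.
split=> s t st; first by rewrite ler_pM2l // mono.
by rewrite -mulrBr ler_pM2l // !maxEle; case: ifP; case: ifP; lra.
Qed.

Section SegmentSums.
Context (R : realType) d (X : porderType d) (W : rel X) (m : X -> X).
Hypothesis tX : tree_order [set: X].
Hypothesis Wwo : well_order W.
Hypothesis m_ge : forall x, x <= m x.
Hypothesis m_min : forall x a, x <= a -> W (m x) a.
Context (e : X -> X -> R) (mt : X -> X -> X).
Hypothesis che : forall a, chart a (e a).
Hypothesis mtl : forall a x, mt a x <= x.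
Hypothesis mtr : forall a x, mt a x <= a.
Hypothesis mtP : forall a x z, z <= x -> z <= a -> z <= mt a x.
Context (o p : X -> X) (g : X -> R).
Hypothesis mo : forall a, nontrivial_segment m a -> m (o a) = a.
Hypothesis mp : forall a, nontrivial_segment m a -> m (p a) = a.
Hypothesis op : forall a, nontrivial_segment m a -> o a < p a.
Hypothesis pa : forall a, nontrivial_segment m a -> p a < a.
Hypothesis g_lt : forall a, nontrivial_segment m a -> g (o a) < g (p a).
Hypothesis g_lt2 : forall a b, nontrivial_segment m a ->
  nontrivial_segment m b -> p a < o b -> g (p a) < g (o b).
Hypothesis g_bd : forall x, -1 <= g x <= 1.

(** Chosen so that the growth attains exactly [g (p a) - g (o a)] at the top [a]. *)
Definition segment_slope (a : X) : R :=
  (g (p a) - g (o a)) / (e a a - e a (p a)).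

(** The meet [mt a x] freezes the value once a chain leaves the down-set of [a]. On trivial segments
    [o a] and [p a] carry no information, hence the default [0]. *)
Definition segment_growth (a x : X) : R :=
  if `[<nontrivial_segment m a>]
  then segment_slope a * Num.max 0 (e a (mt a x) - e a (p a)) else 0.

Lemma e_top a : nontrivial_segment m a -> e a (p a) < e a a.
Proof. by move=> ga; rewrite (chart_lt (che a)) ?pa // ltW // pa. Qed.

Lemma segment_slope_gt0 a : nontrivial_segment m a -> 0 < segment_slope a.
Proof. by move=> ga; rewrite divr_gt0 // subr_gt0 ?g_lt ?e_top. Qed.

Lemma segment_growth_ge0 a x : 0 <= segment_growth a x.
Proof.
rewrite /segment_growth; case: asboolP => // ga.
by rewrite mulr_ge0 ?le_max ?lexx // ltW // segment_slope_gt0.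
Qed.

Lemma segment_growth_le a x : nontrivial_segment m a ->
  segment_growth a x <= g (p a) - g (o a).
Proof.
move=> ga; rewrite /segment_growth asboolT //.
rewrite /segment_slope mulrAC ler_pdivrMr ?subr_gt0 ?e_top //.
rewrite ler_pM2l ?subr_gt0 ?g_lt // ge_max subr_ge0 lerB //.
  by rewrite (ltW (e_top ga)).
by have [em _] := che a; rewrite em.
Qed.

Lemma segment_growth_gt0 a x : 0 < segment_growth a x ->
  nontrivial_segment m a /\ p a <= x.
Proof.
rewrite /segment_growth; case: asboolP => [ga|_]; last by rewrite ltxx.
rewrite pmulr_rgt0 ?segment_slope_gt0 // lt_max ltxx subr_gt0.
rewrite (chart_lt (che a)) ?mtr ?(ltW (pa ga)) // => /ltW pm.
by split=> //; exact: le_trans pm (mtl a x).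
Qed.

Lemma jumpless_segment_growth a : jumpless (segment_growth a).
Proof.
have [ga|nga] := pselect (nontrivial_segment m a); last first.
  by rewrite /segment_growth asboolF //; exact: jumpless_cst.
have [h1 h2] := clamp_homo_lipschitz (e a (p a)) (segment_slope_gt0 ga).
have := jumpless_comp (segment_slope_gt0 ga) h1 h2
  (jumpless_chart_meet tX (che a) (mtl a) (mtr a) (@mtP a)).
by congr jumpless; apply/funext => x; rewrite /segment_growth asboolT.
Qed.

Lemma segment_growth_lt a x y :
  nontrivial_segment m a -> x < y -> y <= a -> p a < y ->
  segment_growth a x < segment_growth a y.
Proof.
move=> ga xy ya py; have xa := le_trans (ltW xy) ya.
have mtid z : z <= a -> mt a z = z.
  by move=> za; apply: le_anti; rewrite mtl mtP.
rewrite /segment_growth asboolT // !mtid // ltr_pM2l ?segment_slope_gt0 //.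
have : e a (p a) < e a y by rewrite (chart_lt (che a)) ?(ltW (pa ga)).
have : e a x < e a y by rewrite (chart_lt (che a)).
by rewrite !maxEle; case: ifP; case: ifP; lra.
Qed.

(* If [p a < p b] lie on a common chain then the segment of [b] starts above
   [p a], so that the jumps of [g] over the two pairs do not overlap. *)
Lemma segment_growth_sum_le (J : seq X) x : uniq J ->
  \sum_(a <- J) segment_growth a x <= 2.
Proof.
move=> uJ; pose P a := 0 < segment_growth a x.
(* Dropping the null terms leaves only segments with [p a] below [x], so that these points are
   comparable. *)
have -> : \sum_(a <- J) segment_growth a x =
    \sum_(a <- [seq a <- J | P a]) segment_growth a x.
  rewrite big_filter [RHS]big_mkcond; apply: eq_bigr => a _.
  by rewrite /P lt_neqAle segment_growth_ge0 andbT; case: eqP.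
have JP a : a \in [seq a <- J | P a] -> nontrivial_segment m a /\ p a <= x.
  by rewrite mem_filter => /andP[/segment_growth_gt0].
apply: (@le_trans _ _ (\sum_(a <- [seq a <- J | P a]) (g (p a) - g (o a)))).
  rewrite big_seq [leRHS]big_seq; apply: ler_sum => a /JP[ga _].
  exact: segment_growth_le.
(* The bound is the length of [[-1, 1]], where [g] takes its values. *)
have -> : 2 = 1 - (-1) :> R by lra.
apply: sum_disjoint_le => [||a _|a /JP[/g_lt]|a b /JP[ga pax] /JP[gb pbx] ab] //.
- exact: filter_uniq.
- lra.
- by have := g_bd (o a); have := g_bd (p a); lra.
wlog pab : a b ga gb pax pbx ab / p a <= p b.
  move=> wl; have /orP[pab|pba] := tree_order_comparable tX pax pbx.
    exact: wl.
  by rewrite eq_sym in ab; have [] := wl b a gb ga pbx pax ab pba; [right|left].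
left; apply/ltW/g_lt2 => //.
have obx : o b <= x by exact: le_trans (ltW (op gb)) pbx.
have oap : p a != o b.
  by apply: contraNneq ab => /(congr1 m); rewrite mp // mo // => ->.
rewrite lt_neqAle oap /=.
(* If [o b <= p a <= p b], monotonicity of [m] compares [a] and [b] under [W] both ways and forces
   [a = b]. *)
have /orP[//|opab] := tree_order_comparable tX pax obx.
have := segment_homo m_ge m_min opab; have := segment_homo m_ge m_min pab.
rewrite !mp // mo // => ab' ba'.
by rewrite (well_order_anti Wwo ab' ba') eqxx in ab.
Qed.

End SegmentSums.

(** * Construction of the continuous grading *)

Lemma continuously_gradable_of_subtrees (R : realType) d (X : porderType d) :
  branchwise_real_tree_order R X ->
  (forall T : set X, well_stratified_tree T -> R_gradable R T) ->
  continuously_gradable R X.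
Proof.
move=> hX hT; have [tX _ infX] := hX.
have [[r _ rle'] _] := tX; have {rle'} rle x : r <= x by exact: (rle' x I).
have [e che] := choice (fun a => chart_exists a hX).
have [mt mtP'] := choice (fun ax : X * X => infX ax.1 ax.2).
pose mt2 a x := mt (a, x).
have mtl a x : mt2 a x <= x by have [+ _] := mtP' (a, x); apply; right.
have mtr a x : mt2 a x <= a by have [+ _] := mtP' (a, x); apply; left.
have mtP a x z : z <= x -> z <= a -> z <= mt2 a x.
  by move=> zx za; have [_] := mtP' (a, x); apply=> _ [->|->].
have [W Wwo] := well_ordering_principle X.
have mex x : exists a, x <= a /\ forall b, x <= b -> W a b.
  have [|a xa amin] := @well_order_min _ W (fun a => x <= a) Wwo.
    by exists x.
  by exists a.
have [m mP] := choice mex.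
have m_ge x : x <= m x by case: (mP x).
have m_min x a : x <= a -> W (m x) a by case: (mP x) => _; apply.
have pex a : exists p : nat -> X, nontrivial_segment m a ->
    (forall n, [/\ m (p n) = a, p n < a & p n.+1 < p n]) /\
    forall x y, m x = a -> m y = a -> x < y -> exists n, p n < y.
  have [[x0 x0a mx0]|nga] := pselect (nontrivial_segment m a); last first.
    by exists (fun=> a).
  have [||||p pP] := @coinitial_sequence R d X r a x0 (e a)
    [set x | m x = a] rle (che a) => //.
  - by move=> x <-.
  - by move=> x y; exact: (segment_up Wwo m_ge m_min).
  - by exists p.
have [p pP] := choice pex.
(* Consecutive terms of the sequence serve as the pair: [p a n.+1] as lower point and [p a n] as
   upper point. *)
pose T n := [set x | x = r \/
  exists2 a, nontrivial_segment m a & x = p a n.+1 \/ x = p a n].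
have wT n : well_stratified_tree (T n).
  apply: (@well_stratified_pairs _ _ _ W) => // a ga.
  by have [pn _] := pP a ga; have [? _ ?] := pn n; have [? _ _] := pn n.+1.
have [l lP] := choice (fun n => hT (T n) (wT n)).
(* [contract] is strictly increasing with values in [[-1, 1]], which makes the grading bounded. *)
pose g n x := contract (l n x)%:E.
have gT n x y : T n x -> T n y -> x < y -> g n x < g n y.
  by move=> Tx Ty xy; rewrite lt_contract lte_fin lP ?inE.
have Tp n a : nontrivial_segment m a -> T n (p a n) by right; exists a; [|right].
have To n a : nontrivial_segment m a -> T n (p a n.+1) by right; exists a; [|left].
have g_bd n x : -1 <= g n x <= 1 by rewrite -ler_norml contract_le1.
have pm n a : nontrivial_segment m a -> m (p a n) = a.
  by move=> /pP[/(_ n)[]].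
have pa n a : nontrivial_segment m a -> p a n < a.
  by move=> /pP[/(_ n)[]].
have pp n a : nontrivial_segment m a -> p a n.+1 < p a n.
  by move=> /pP[/(_ n)[]].
pose phi n := segment_growth m e mt2 (fun a => p a n.+1) (fun a => p a n) (g n).
have g_lt n a : nontrivial_segment m a -> g n (p a n.+1) < g n (p a n).
  by move=> ga; apply: gT; [exact: To|exact: Tp|exact: pp].
have phi0 n a x : 0 <= phi n a x.
  by apply: (segment_growth_ge0 mt2 che (pa n) (g_lt n)).
have phi_sum n J x : uniq J -> \sum_(a <- J) phi n a x <= 2.
  apply: (segment_growth_sum_le tX Wwo m_ge m_min che mtl mtr) =>
    // [b|b|b|b|b|b c gb gc].
  - exact: pm.
  - exact: pm.
  - exact: pp.
  - exact: pa.
  - exact: g_lt.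
  - by apply: gT; [exact: Tp|exact: To].
have phi_jl n a : jumpless (phi n a).
  by exact: (jumpless_segment_growth tX che mtl mtr mtP (pa n) (g_lt n)).
pose F n := sup_sum (phi n).
have F0 n x : 0 <= F n x by exact: sup_sum_ge0 (phi_sum n) x.
have F2 n x : F n x <= 2 by apply: sup_sum_le => J uJ; exact: phi_sum.
have Fj n : jumpless (F n) by exact: jumpless_sup_sum (phi_sum n) _.
pose psi n x := 2^-1 ^+ n * F n x.
have h0 n : 0 < (2^-1 : R) ^+ n by rewrite exprn_gt0 // invr_gt0.
have psi0 n x : 0 <= psi n x by rewrite mulr_ge0 // ltW.
have psij n : jumpless (psi n).
  apply: (@jumpless_comp _ _ _ (F n) (fun t => 2^-1 ^+ n * t) (2^-1 ^+ n)) => //.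
    by move=> s t st; rewrite ler_pM2l.
  by move=> s t st; rewrite mulrBr.
(* One factor [2] bounds each [F n], the other the sum of the weights. *)
have psi_sum (J : seq nat) x : uniq J -> \sum_(n <- J) psi n x <= 2 * 2.
  move=> uJ; apply: (@le_trans _ _ (\sum_(n <- J) 2^-1 ^+ n * 2)).
    by apply: ler_sum => n _; rewrite ler_pM2l.
  by rewrite -mulr_suml ler_pM2r // sum_half_le2.
exists (sup_sum psi); apply: (jumpless_continuous_grading tX che).
  exact: jumpless_sup_sum psi_sum _.
move=> x y xy; have [fm _ _] := jumpless_sup_sum psi0 psi_sum psij.
have [z /andP[xz zy] zseg] := interval_segment Wwo m_ge m_min xy.
apply: lt_le_trans (fm _ _ zy).
have [em es] := che z.
have exz : e z x < e z z by rewrite (chart_lt (che z)) // ltW.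
(* A midpoint [w] of [x] and [z] lies in the segment of [z]: this segment is nontrivial and [z] is
   not its least element, so some [p n] lies below [z]. *)
have [|w /andP[xw wz] ew] := es x z ((e z x + e z z) / 2) (ltW xz) (lexx z).
  lra.
have wz' : w < z by rewrite -(chart_lt (che z)) // ew; lra.
have xw' : x < w by rewrite -(chart_lt (che z)) ?(ltW xz) // ew; lra.
have mw : m w = m z by apply: zseg; rewrite xw'.
have ga : nontrivial_segment m (m z).
  by exists w => //; exact: lt_le_trans wz' (m_ge z).
have [_ /(_ w z mw erefl wz')[n pz]] := pP _ ga.
apply: (@sup_sum_lt _ _ _ _ _ _ psi0 psi_sum psij n); first exact: ltW.
rewrite ltr_pM2l //.
apply: (@sup_sum_lt _ _ _ _ _ _ (phi0 n) (phi_sum n) (phi_jl n) (m z)).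
  exact: ltW.
by apply: (segment_growth_lt che mtl mtP (pa n) (g_lt n)).
Qed.

Theorem theorem4p1 (R : realType) (d : Order.disp_t) (X : porderType d)
    (hX : branchwise_real_tree_order R X) :
  continuously_gradable R X <->
  forall T : set X, well_stratified_tree T -> R_gradable R T.
Proof.
(* A continuous grading is strictly monotone on all of [X], so it restricts to a grading of [T]. *)
split=> [[l [lgr _]] T _|hT]; last exact: continuously_gradable_of_subtrees.
by exists l => x y _ _; apply: lgr; rewrite inE.
Qed.
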